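(* Let $(R_n)_{n\ge 1}$ be a positive increasing sequence with $R_n\to+\infty$ and $\lim_{n\to\infty}\frac{R_n}{n}=0$. For any constant $k>0$ and for every sufficiently large $n$ (depending on $k$ and the sequence), there exists a convex body $K\subset\mathbb{R}^n$ in John's position such that there is no polytope $P\subset\mathbb{R}^n$ that has at most $n^k$ facets and satisfies $$K\subset P\subset R_nK.$$
   Context: A convex body in $\mathbb{R}^n$ is a compact convex set with non-empty interior. The John ellipsoid of a convex body is the unique ellipsoid of maximal volume contained in it. A convex body is in John's position if its John ellipsoid is the Euclidean unit ball $B_2^n$ centered at the origin. A polytope is a compact convex polytope, and its number of facets is the number of its $(n-1)$-dimensional faces. For $R>0$, $RK=\{Rx : x\in K\}$. *)

(* Defs.v *)
From HB Require Import structures.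
From mathcomp Require Import all_boot all_order all_algebra.
From mathcomp Require Import all_classical all_reals all_analysis.

Set Implicit Arguments.
Unset Strict Implicit.
Unset Printing Implicit Defensive.

Import Order.TTheory GRing.Theory Num.Theory.
Import numFieldNormedType.Exports.

Local Open Scope classical_set_scope.
Local Open Scope ring_scope.

Section Defs.
Variables (R : realType) (n : nat).
Implicit Types (A K P F E : set 'rV[R]_n) (u x : 'rV[R]_n) (V : 'M[R]_n).

Definition dot u x : R := \sum_(i < n) u 0 i * x 0 i.

(* The topology of 'rV[R]_n is the product topology, i.e. the Euclidean one. *)
Definition convex_body K :=
  [/\ compact K, convex_set (K : set (convex_lmodType 'rV[R]_n))
    & interior K !=set0].

Definition unit_ball : set 'rV[R]_n := [set x | dot x x <= 1].

Definition ellipsoid E :=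
  exists (c : 'rV[R]_n) (M : 'M[R]_n),
    M \in unitmx /\ E = [set c + x *m M | x in unit_ball].

Definition box (a b : 'rV[R]_n) : set 'rV[R]_n :=
  [set x | forall i, a 0 i <= x 0 i <= b 0 i].

Definition box_cover A (p : nat -> 'rV[R]_n * 'rV[R]_n) :=
  (forall k i, (p k).1 0 i <= (p k).2 0 i) /\
  A `<=` \bigcup_k box (p k).1 (p k).2.

(* The n-dimensional Lebesgue outer measure, which is the Lebesgue measure on
   measurable sets (it is only applied to ellipsoids, which are compact). *)
Definition volume A : \bar R :=
  ereal_inf [set (\sum_(k <oo)
                    (\prod_(i < n) ((p k).2 0 i - (p k).1 0 i))%:E)%E
            | p in box_cover A].

Definition max_volume_ellipsoid K E :=
  [/\ ellipsoid E, E `<=` K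
    & forall E', ellipsoid E' -> E' `<=` K -> (volume E' <= volume E)%E].

Definition john_ellipsoid K E := unique (max_volume_ellipsoid K) E.

Definition john_position K := john_ellipsoid K unit_ball.

Definition convex_hull A : set 'rV[R]_n :=
  smallest (fun B : set (convex_lmodType 'rV[R]_n) => convex_set B) A.

Definition polytope P := exists s : seq 'rV[R]_n, P = convex_hull [set` s].

(* The translate by x of the row space of V. *)
Definition affine_subspace x V : set 'rV[R]_n := [set y | (y - x <= V)%MS].

Definition affine_hull A : set 'rV[R]_n :=
  smallest (fun B => exists x V, B = affine_subspace x V) A.

(* For n > 0 no d satisfies [has_dim set0 d]. *)
Definition has_dim A (d : nat) :=
  exists x V, affine_hull A = affine_subspace x V /\ \rank V = d.

(* Taking u = 0 makes P itself, and the empty set, faces of P. *)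
Definition face P F :=
  exists u (c : R), (forall x, P x -> dot u x <= c) /\
                    F = P `&` [set x | dot u x = c].

Definition facets P : set (set 'rV[R]_n) :=
  [set F | face P F /\ exists2 d : nat, has_dim F d & d.+1 = n].

Definition dilate (t : R) K : set 'rV[R]_n := [set t *: x | x in K].

End Defs.

(* Main.v *)
Require Import Defs.
From mathcomp Require Import all_boot all_order all_algebra.
From mathcomp Require Import all_classical all_reals all_analysis.
From mathcomp Require Import measurable_realfun.
From mathcomp Require Import zify ring lra.

(** Why the theorem is true.

Let u_0, ..., u_n be the vertices of a regular simplex inscribed in the unit
sphere, so that distinct vertices have scalar product -1/n, and single out one
of them, p. Fix an integer s, which depends on k only. A set I of s vertices
other than p is attached two vectors:
- a functional y_I, proportional to the sum over I of p - u_i, of norm at most 1;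
- a point w_I, proportional to -(s - 1) p - s (sum of u_i over I), of norm of
  order n.
The scalar product of p - u_i with p is 1 + 1/n, and with another vertex u_j it
is -(1 + 1/n) if i = j and 0 otherwise. Hence the scalar product of y_I and w_J
is (n + 1) / (4 s^2) times #(I and J) - s + 1: it is of order n if I = J and
nonpositive otherwise. On the other hand w_J is not cut off by the simplex: its
scalar products with all the u_i are at most 1. The body is

  K = {x | (u_i, x) <= 1 for all i and (y_I, x) <= 1 for all I}.

It lies between the ball and the simplex circumscribed about it, whose facets
touch the ball at the u_i, and John's criterion says that the ball is the John
ellipsoid of K ([john_position_contact]).

Suppose that P contains K and is contained in rho K with rho of order less than
n. The functional y_I / rho is at most 1 on P and exceeds 1 at w_I, hence some
facet of P separates w_I from P ([separating_facet]). If a single facet did this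
for more than n sets I, it would also separate the average of the corresponding
points w_I. That average belongs to K: for each y_I the sum has at most one
positive term, which is at most n + 1, and the sum is divided by at least n + 1
([mean_spikes_in_body]). So each facet serves at most n sets, and P has at least
'C(n, s) / n facets. As s is fixed this is of order n^(s-1), more than n^k if
s is larger than k + 1.

John's criterion is proved for the volume defined by covers with boxes. An
ellipsoid is a translate of the image of the ball under an upper triangular
matrix U with positive diagonal ([ellipsoid_trig]), because the ball is invariant
under rotations. The volume of the image is at most the product of the diagonal
entries times the volume of the ball ([volume_upper_trig]), since U is a product
of shears, for which the bound is seen by slicing boxes. The contact points bound
the trace of U by n, and the inequality between the arithmetic and geometric
means finishes the comparison. Its equality case needs the ball to have positive
finite volume ([volume_unit_ball_gt0], [volume_unit_ball_fin]). *)

Set Implicit Arguments.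
Unset Strict Implicit.
Unset Printing Implicit Defensive.

Import Order.TTheory GRing.Theory Num.Theory.
Import numFieldNormedType.Exports.

Local Open Scope classical_set_scope.
Local Open Scope ring_scope.

(** * The scalar product *)

Section ScalarProduct.
Variables (R : realType) (n : nat).
Implicit Types (u v x : 'rV[R]_n) (A : 'M[R]_n) (a : R).

Lemma dotE u x : dot u x = (u *m x^T) 0 0.
Proof. by rewrite mxE; apply: eq_bigr => i _; rewrite mxE. Qed.

Lemma dotC u x : dot u x = dot x u.
Proof. by apply: eq_bigr => i _; rewrite mulrC. Qed.

Lemma dotDl u v x : dot (u + v) x = dot u x + dot v x.
Proof. by rewrite !dotE mulmxDl mxE. Qed.

Lemma dotZl a u x : dot (a *: u) x = a * dot u x.
Proof. by rewrite !dotE -scalemxAl mxE. Qed.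

Lemma dotNl u x : dot (- u) x = - dot u x.
Proof. by rewrite -scaleN1r dotZl mulN1r. Qed.

Lemma dotBl u v x : dot (u - v) x = dot u x - dot v x.
Proof. by rewrite dotDl dotNl. Qed.

Lemma dotDr x u v : dot x (u + v) = dot x u + dot x v.
Proof. by rewrite dotC dotDl !(dotC x). Qed.

Lemma dotZr a x u : dot x (a *: u) = a * dot x u.
Proof. by rewrite dotC dotZl (dotC x). Qed.

Lemma dotNr x u : dot x (- u) = - dot x u.
Proof. by rewrite dotC dotNl (dotC x). Qed.

Lemma dotBr x u v : dot x (u - v) = dot x u - dot x v.
Proof. by rewrite dotDr dotNr. Qed.

Lemma dot0l x : dot 0 x = 0.
Proof. by rewrite -(scale0r 0) dotZl mul0r. Qed.

Lemma dot_suml (I : Type) (r : seq I) (P : pred I) (F : I -> 'rV[R]_n) x :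
  dot (\sum_(i <- r | P i) F i) x = \sum_(i <- r | P i) dot (F i) x.
Proof.
apply: (big_morph (fun u => dot u x)) => [u v|]; first exact: dotDl.
exact: dot0l.
Qed.

Lemma dot_sumr (I : Type) (r : seq I) (P : pred I) (F : I -> 'rV[R]_n) x :
  dot x (\sum_(i <- r | P i) F i) = \sum_(i <- r | P i) dot x (F i).
Proof. by rewrite dotC dot_suml; apply: eq_bigr => i _; rewrite dotC. Qed.

Lemma dot_mulmx u A x : dot (u *m A) x = dot u (x *m A^T).
Proof. by rewrite !dotE trmx_mul trmxK mulmxA. Qed.

Lemma dot_ge0 x : 0 <= dot x x.
Proof. by apply: sumr_ge0 => i _; rewrite -expr2 sqr_ge0. Qed.

Lemma dot_eq0 x : dot x x = 0 -> x = 0.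
Proof.
move=> /eqP; rewrite psumr_eq0 => [/allP x0|i _]; last by rewrite -expr2 sqr_ge0.
apply/rowP => i; rewrite mxE; apply/eqP.
by have := x0 i (mem_index_enum i); rewrite /= mulf_eq0 orbb.
Qed.

Lemma dot_gt0 x : x != 0 -> 0 < dot x x.
Proof.
move=> x0; rewrite lt_neqAle dot_ge0 andbT eq_sym.
by apply: contra_neq x0; exact: dot_eq0.
Qed.

Lemma dot_le1 u x : dot u u <= 1 -> dot x x <= 1 -> dot u x <= 1.
Proof.
move=> u1 x1; have := dot_ge0 (u - x).
by rewrite dotBl !dotBr (dotC x u); lra.
Qed.

Lemma dot_unit_sqr_le u x : dot u u = 1 -> dot x u ^+ 2 <= dot x x.
Proof.
move=> u1; have := dot_ge0 (x - dot x u *: u).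
rewrite dotBl !dotBr !dotZl !dotZr (dotC u x) u1; lra.
Qed.

Lemma dot_delta u i : dot u (delta_mx 0 i) = u 0 i.
Proof.
rewrite /dot (bigD1 i)//= !mxE !eqxx mulr1 big1 ?addr0// => j ji.
by rewrite mxE (negbTE ji) andbF mulr0.
Qed.

End ScalarProduct.

(** * Volume and linear maps *)

Section Volume.
Variables (R : realType) (n : nat).
Implicit Types (A B : set 'rV[R]_n) (q : 'rV[R]_n * 'rV[R]_n).
Implicit Types (p : nat -> 'rV[R]_n * 'rV[R]_n).

Definition box_vol q : R := \prod_(i < n) (q.2 0 i - q.1 0 i).

Lemma box_vol_ge0 q : (forall i, q.1 0 i <= q.2 0 i) -> 0 <= box_vol q.
Proof. by move=> q12; apply: prodr_ge0 => i _; rewrite subr_ge0. Qed.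

Lemma volume_le_cover A p : box_cover A p ->
  (volume A <= \sum_(k <oo) (box_vol (p k))%:E)%E.
Proof. by move=> Ap; apply: ereal_inf_lbound; exists p. Qed.

Lemma volume_ge0 A : (0 <= volume A)%E.
Proof.
apply: le_ereal_inf_tmp => _ [p [p12 _] <-].
by apply: nneseries_ge0 => k _ _; rewrite lee_fin box_vol_ge0.
Qed.

Lemma le_volume A B : A `<=` B -> (volume A <= volume B)%E.
Proof.
move=> AB; apply: le_ereal_inf_tmp => _ [p [p12 pB] <-].
by apply: volume_le_cover; split => //; exact: subset_trans pB.
Qed.

(** Reduces the volume of an image to the volumes of the images of boxes. *)
Lemma volume_sigma_subadditive (A : nat -> set 'rV[R]_n) :
  (volume (\bigcup_k A k) <= \sum_(k <oo) volume (A k))%E.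
Proof.
have [[i Aioo]|/forallNP Afin] := pselect (exists i, volume (A i) = +oo%E).
  rewrite (eseries_pinfty _ _ Aioo) ?leey// => j _.
  by rewrite -ltNye (lt_le_trans _ (volume_ge0 _)).
apply/lee_addgt0Pr => e e0.
apply: le_trans (epsilon_trick _ (fun k => volume_ge0 (A k)) (ltW e0)).
have cover k : exists p, box_cover (A k) p /\
    (\sum_(j <oo) (box_vol (p j))%:E <=
     volume (A k) + (e / (2 ^ k.+1)%:R)%:E)%E.
  have vfin : volume (A k) \is a fin_num.
    by rewrite ge0_fin_numE ?volume_ge0// ltey; apply/eqP/Afin.
  have ek : 0 < e / (2 ^ k.+1)%:R by rewrite divr_gt0// ltr0n expn_gt0.
  have [_ [p Ap <-] /ltW pe] := lb_ereal_inf_adherent ek vfin.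
  by exists p.
have [G GP] := choice cover.
have G12 k j i : (G k j).1 0 i <= (G k j).2 0 i by exact: (GP k).1.1.
(* The covers of the pieces are merged along a bijection of N with N * N. *)
have /card_esym/ppcard_eqP[f] := card_nat2.
have GAf : box_cover (\bigcup_k A k) (fun l => G (f l).1 (f l).2).
  split => [l i|x [k _ /((GP k).1.2 x)[j _ xj]]]; first exact: G12.
  by exists (f^-1%FUN (k, j)) => //=; rewrite invK ?inE.
apply: le_trans (volume_le_cover GAf) _.
apply: le_trans (lee_nneseries _ (fun k _ => (GP k).2)); last first.
  by move=> k _ _; apply: nneseries_ge0 => j _ _; rewrite lee_fin box_vol_ge0.
have G0 k j : (0 <= (box_vol (G k j))%:E)%E by rewrite lee_fin box_vol_ge0.
rewrite nneseries_esumT; last by move=> l; exact: G0.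
rewrite (eq_eseriesr
  (g := fun k => \esum_(j in setT) (box_vol (G k j))%:E)%E); last first.
  by move=> k _; rewrite nneseries_esumT.
rewrite [leRHS]nneseries_esumT; last by move=> k; exact: esum_ge0.
rewrite esum_esum//.
rewrite (_ : setT `*`` (fun=> setT) = [set: nat * nat]); last first.
  by apply/seteqP; split.
by rewrite (reindex_esum setT setT f).
Qed.

(** The infimum over covers only sees boxes, so a bound on the volumes of the
    images of boxes is a bound on the volumes of all images. *)
Lemma volume_image_le (f : 'rV[R]_n -> 'rV[R]_n) (t : R) : 0 < t ->
  (forall q, (forall i, q.1 0 i <= q.2 0 i) ->
     (volume (f @` box q.1 q.2) <= (t * box_vol q)%:E)%E) ->
  forall A, (volume (f @` A) <= t%:E * volume A)%E.
Proof.
move=> t0 fbox A; rewrite /volume -[X in (_ <= X)%E]ereal_inf_pZl//.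
apply: le_ereal_inf_tmp => _ [_ [p [p12 Ap] <-] <-].
rewrite -nneseriesZl; last by move=> k _; rewrite lee_fin box_vol_ge0.
have : f @` A `<=` \bigcup_k (f @` box (p k).1 (p k).2).
  by move=> _ [x /Ap[k _ xk] <-]; exists k => //; exists x.
move=> /le_volume /le_trans; apply.
apply: le_trans (volume_sigma_subadditive _) _.
apply: lee_nneseries => k _ ; first by move=> _; exact: volume_ge0.
by rewrite -EFinM; exact: fbox.
Qed.

End Volume.

Section LinearImage.
Variables (R : realType) (n : nat).
Implicit Types (A : set 'rV[R]_n) (a b v : 'rV[R]_n).

Lemma strip_exists (a h x : R) (N : nat) : a <= x <= a + h * N.+1%:R ->
  exists2 l, (l < N.+1)%N & a + h * l%:R <= x <= a + h * l.+1%:R.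
Proof.
elim: N => [|N IH] /andP[ax xN].
  by exists 0%N => //; rewrite mulr0 addr0 ax.
have [xlt|xge] := leP x (a + h * N.+1%:R).
  have [|l lN xl] := IH; first by rewrite ax.
  by exists l => //; rewrite ltnS ltnW.
by exists N.+1 => //; rewrite (ltW xge).
Qed.

Lemma volume_le_finite_cover A N (q : nat -> 'rV[R]_n * 'rV[R]_n) :
  (0 < n)%N ->
  (forall l i, (q l).1 0 i <= (q l).2 0 i) ->
  (forall x, A x -> exists2 l, (l < N)%N & box (q l).1 (q l).2 x) ->
  (volume A <= (\sum_(l < N) box_vol (q l))%:E)%E.
Proof.
move=> n0 q12 Aq.
pose p l := if (l < N)%N then q l else (0, 0).
have Ap : box_cover A p.
  split => [k i|x /Aq[l lN xl]]; first by rewrite /p; case: ifP.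
  by exists l => //; rewrite /p lN.
apply: le_trans (volume_le_cover Ap) _.
have p0 l : (N <= l)%N -> box_vol (p l) = 0.
  rewrite /p ltnNge => ->/=; rewrite /box_vol.
  by rewrite (bigD1 (Ordinal n0))//= subrr mul0r.
rewrite (nneseries_split 0 N); last first.
  move=> k _; rewrite lee_fin box_vol_ge0// => i.
  by case: Ap.
rewrite add0n eseries0; last by move=> l Nl _; rewrite p0.
rewrite adde0 big_mkord sumEFin lee_fin ler_sum// => l _.
by rewrite /p ltn_ord.
Qed.

(** Right multiplication by the identity matrix with [v] added to its row [k]. *)
Definition row_shear (k : 'I_n) v (x : 'rV[R]_n) := x + x 0 k *: v.

(** Cut the box into [N] strips along coordinate [k]. On each strip the shear
    is a translation up to an error of order [1/N] in the other coordinates, so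
    the image of the strip fits into a box that is barely too large. *)
Lemma volume_row_shear_box (k : 'I_n) v a b (t := 1 + v 0 k) : 0 < t ->
  (forall i, a 0 i <= b 0 i) ->
  (volume (row_shear k v @` box a b) <= (t * box_vol (a, b))%:E)%E.
Proof.
move=> t0 ab; have n0 : (0 < n)%N by exact: leq_ltn_trans (ltn_ord k).
pose w := b 0 k - a 0 k; have w0 : 0 <= w by rewrite subr_ge0.
pose p : {poly R} := (t * w)%:P *
  \prod_(j < n | j != k) ((b 0 j - a 0 j)%:P + (2 * `|v 0 j| * w) *: 'X).
have pE e : p.[e] =
    t * w * \prod_(j < n | j != k) (b 0 j - a 0 j + 2 * `|v 0 j| * w * e).
  rewrite hornerM hornerC horner_prod; congr (_ * _).
  by apply: eq_bigr => j _; rewrite hornerD hornerC hornerZ hornerX.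
have volp N : (volume (row_shear k v @` box a b) <= p.[harmonic N]%:E)%E.
  pose h := w / N.+1%:R; have h0 : 0 <= h by rewrite divr_ge0.
  pose s l := a 0 k + h * l%:R.
  pose lo l := \row_j (if j == k then t * s l
                       else a 0 j + s l * v 0 j - `|v 0 j| * h).
  pose hi l := \row_j (if j == k then t * s l.+1
                       else b 0 j + s l * v 0 j + `|v 0 j| * h).
  have sS l : s l.+1 = s l + h by rewrite /s -natr1 mulrDr mulr1 addrA.
  apply: le_trans (volume_le_finite_cover (N := N.+1)
    (q := fun l => (lo l, hi l)) n0 _ _) _.
  - move=> l i /=; rewrite !mxE; case: eqP => _.
      by rewrite ler_pM2l// sS lerDl.
    have := ab i; have := mulr_ge0 (normr_ge0 (v 0 i)) h0; lra.
  - move=> _ [x xab <-].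
    have [|l lN /andP[slx xsl]] := @strip_exists (a 0 k) h (x 0 k) N.
      by rewrite /h divfK// /w addrC subrK xab.
    exists l => // i; rewrite !mxE; case: eqP => [->|_].
      rewrite -{1 3}(mul1r (x 0 k)) (mulrC (x 0 k)) -mulrDl.
      by rewrite !ler_pM2l// slx.
    rewrite -/(s l) -/(s l.+1) sS in slx xsl.
    have /andP[ax xb] := xab i.
    have : `|(x 0 k - s l) * v 0 i| <= `|v 0 i| * h.
      rewrite normrM mulrC ler_wpM2l// ger0_norm; first lra.
      by rewrite subr_ge0.
    by rewrite ler_norml => /andP[]; lra.
  rewrite lee_fin pE le_eqVlt; apply/orP; left; apply/eqP.
  have tw : t * w = \sum_(l < N.+1) (t * h).
    by rewrite sumr_const card_ord -mulrnAr -mulr_natr /h divfK.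
  rewrite [in RHS]tw mulr_suml; apply: eq_bigr => l _.
  rewrite /box_vol (bigD1 k)//= !mxE eqxx sS; congr (_ * _); first by ring.
  apply: eq_bigr => j /negbTE jk; rewrite !mxE jk /h /harmonic/=; ring.
have volfin : volume (row_shear k v @` box a b) \is a fin_num.
  by rewrite ge0_fin_numE ?volume_ge0// (le_lt_trans (volp 0%N))// ltry.
have p0 : p.[0] = t * box_vol (a, b).
  rewrite pE /box_vol [in RHS](bigD1 k)//= mulrA; congr (_ * _).
  by apply: eq_bigr => j _; rewrite mulr0 addr0.
rewrite -(fineK volfin) lee_fin -p0.
have pcvg : p.[harmonic N] @[N --> \oo] --> p.[0].
  apply: (@cvg_comp _ _ _ harmonic (horner p) _ (nbhs (0 : R))).
    exact: cvg_harmonic.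
  exact: continuous_horner.
rewrite -(cvg_lim _ pcvg)//; apply: limr_ge.
  by apply/cvg_ex; exists p.[0].
by apply: nearW => N; rewrite -lee_fin fineK.
Qed.

End LinearImage.

Section TriangularImage.
Variables (R : realType) (n : nat).
Implicit Types (A : set 'rV[R]_n) (U : 'M[R]_n).

Lemma volume_row_shear (k : 'I_n) (v : 'rV[R]_n) A : 0 < 1 + v 0 k ->
  (volume (row_shear k v @` A) <= (1 + v 0 k)%:E * volume A)%E.
Proof.
by move=> t0; apply: volume_image_le => // -[a b] ab; exact: volume_row_shear_box.
Qed.

(** An upper triangular matrix is the product of the row shears given by its
    rows, the last row acting first. *)
Lemma volume_upper_trig U A : is_trig_mx U^T -> (forall i, 0 < U i i) ->
  (volume [set x *m U | x in A] <= (\prod_i U i i)%:E * volume A)%E.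
Proof.
move=> /is_trig_mxP Utrig U0.
pose V k := \matrix_(i, j) if (i < k)%N then (i == j)%:R else U i j.
suff volV d k : (k + d = n)%N ->
    (volume [set x *m V k | x in A] <=
     (\prod_(i < n | (k <= i)%N) U i i)%:E * volume A)%E.
  have := volV n 0%N erefl.
  rewrite (_ : V 0%N = U); last by apply/matrixP => i j; rewrite mxE.
  by rewrite (eq_bigl xpredT).
elim: d k => [|d IH] k.
  rewrite addn0 => ->; rewrite big_pred0; last by move=> i; rewrite leqNgt ltn_ord.
  rewrite mul1e (_ : V n = 1%:M); last by apply/matrixP => i j; rewrite !mxE ltn_ord.
  by under eq_imagel => x _ do rewrite mulmx1; rewrite image_id.
rewrite addnS -addSn => kd; have kn : (k < n)%N by rewrite -kd leq_addr.
pose k0 := Ordinal kn; pose v := row k0 U - delta_mx 0 k0.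
have v1 : 1 + v 0 k0 = U k0 k0 by rewrite !mxE !eqxx /=; ring.
have Vk0 x : (x *m V k.+1) 0 k0 = x 0 k0.
  rewrite mxE (bigD1 k0)//= mxE ltnSn eqxx mulr1 big1 ?addr0// => i ik.
  rewrite mxE (negbTE ik) ltnS; case: leqP => ki; first by rewrite mulr0.
  by have := Utrig k0 i ki; rewrite mxE => ->; rewrite mulr0.
have VS x : x *m V k = row_shear k0 v (x *m V k.+1).
  rewrite /row_shear Vk0; apply/rowP => j.
  rewrite !mxE (bigD1 k0)//= [X in _ = X + _](bigD1 k0)//=.
  rewrite addrAC; congr (_ + _); last first.
    apply: eq_bigr => i ik; rewrite !mxE ltnS (leq_eqVlt i k).
    by rewrite (_ : (i == k :> nat) = false)//; apply/negbTE.
  by rewrite !mxE ltnn ltnSn /= (eq_sym j); ring.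
rewrite (_ : [set x *m V k | x in A] =
    row_shear k0 v @` [set x *m V k.+1 | x in A]); last first.
  apply/seteqP; split => [_ [x Ax <-]|_ [_ [x Ax <-] <-]].
    by exists (x *m V k.+1); [exists x|rewrite VS].
  by exists x => //; rewrite VS.
apply: le_trans (volume_row_shear _ _) _; first by rewrite v1.
rewrite v1 (bigD1 k0)//= EFinM -muleA lee_pmul2l ?lte_fin//.
apply: le_trans (IH k.+1 kd) _.
rewrite le_eqVlt; apply/orP; left; apply/eqP; congr (_%:E * _)%E.
apply: eq_bigl => i; rewrite ltn_neqAle andbC; congr (_ && _).
by rewrite eq_sym.
Qed.

Lemma volume_translate (c : 'rV[R]_n) A : (0 < n)%N ->
  (volume [set (c + x)%R | x in A] <= volume A)%E.
Proof.
move=> n0; rewrite -[leRHS]mul1e; apply: volume_image_le => // -[a b] /= ab.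
apply: le_trans (volume_le_finite_cover (N := 1)
  (q := fun=> (c + a, c + b)) n0 _ _) _ => /=.
- by move=> _ i; rewrite !mxE lerD2l.
- move=> _ [x xab <-]; exists 0%N => // i.
  by rewrite !mxE !lerD2l.
rewrite big_ord1 mul1r lee_fin le_eqVlt; apply/orP; left; apply/eqP.
by apply: eq_bigr => i _; rewrite !mxE; ring.
Qed.

End TriangularImage.

Section UnitBallVolume.
Variable R : realType.

(** A countable Fubini-Tonelli argument: integrating the last coordinate over
    [[0, d]] replaces the weights by their product with the lengths of the last
    sides. Boxes are given by sequences of coordinates so that the dimension is
    a mere parameter of the induction. *)
Lemma weighted_box_cover (n : nat) (d : R) (e : nat -> R) (a b : nat -> nat -> R)
    (c : R) :
  0 <= d -> 0 <= c -> (forall k, 0 <= e k) -> (forall k i, a k i <= b k i) ->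
  (forall x : nat -> R, (forall i, 0 <= x i <= d) ->
    (c%:E <= \sum_(k <oo)
       (e k * \prod_(i < n) (a k i <= x i <= b k i)%R%:R)%:E)%E) ->
  ((c * d ^+ n)%:E <= \sum_(k <oo) (e k * \prod_(i < n) (b k i - a k i))%:E)%E.
Proof.
move=> d0; elim: n e c => [|n IH] e c c0 e0 ab cov.
  rewrite expr0 mulr1; apply: le_trans (cov (fun=> 0) _) _.
    by move=> i; rewrite lexx d0.
  by apply: lee_nneseries => k _ => [_|]; rewrite !big_ord0 ?lee_fin mulr1.
rewrite exprSr (mulrC _ d) mulrA.
under eq_eseriesr do rewrite big_ord_recr/= mulrCA mulrA mulrC.
rewrite [leRHS](_ : _ = (\sum_(k <oo)
    (e k * (b k n - a k n) * \prod_(i < n) (b k i - a k i))%:E)%E); last first.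
  by apply: eq_eseriesr => k _; congr _%:E; ring.
apply: IH => [||//|x x0d]; first exact: mulr_ge0.
  by move=> k; rewrite mulr_ge0// subr_ge0.
pose P k : R := \prod_(i < n) (a k i <= x i <= b k i)%R%:R.
have P0 k : 0 <= P k by apply: prodr_ge0 => i _; exact: ler0n.
pose D : set R := `[0, d]%classic.
have mD : measurable D by exact: measurable_itv.
pose f k (t : R) : \bar R :=
  ((e k * P k)%:E * (\1_(`[a k n, b k n]%classic) t)%:E)%E.
have f0 k t : (0 <= f k t)%E.
  by rewrite mule_ge0 ?lee_fin ?mulr_ge0.
have mf k : measurable_fun D (f k).
  apply: measurable_funeM; apply/measurable_EFinP.
  exact: measurable_indic.
have covt t : D t -> (c%:E <= \sum_(k <oo) f k t)%E.
  rewrite /D/= in_itv/= => t0d.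
  pose y i := if i == n then t else x i.
  apply: le_trans (cov y _) _; first by move=> i; rewrite /y; case: eqP.
  rewrite le_eqVlt; apply/orP; left; apply/eqP; apply: eq_eseriesr => k _.
  rewrite /f -EFinM big_ord_recr/= mulrA; congr (_ * _ * _)%:E.
    apply: eq_bigr => i _; rewrite /y ifF//.
    by apply/negbTE; rewrite neq_ltn ltn_ord.
  rewrite /y eqxx indicE; congr (_%:R); apply/esym; rewrite mem_setE.
  by rewrite in_itv.
have -> : (c * d)%:E = (\int[lebesgue_measure]_(t in D) (cst c%:E t))%E.
  rewrite integral_cst// EFinM; congr (_ * _)%E.
  rewrite /D/=.
  rewrite lebesgue_measure_itv/= lte_fin.
  by case: ltgtP d0 => // [_ _|<- _]; rewrite ?sube0.
apply: (@le_trans _ _ (\int[lebesgue_measure]_(t in D) (\sum_(k <oo) f k t))%E).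
  apply: ge0_le_integral => //.
  by apply: ge0_emeasurable_sum => k *; [exact: f0|exact: mf].
rewrite integral_nneseries//.
apply: lee_nneseries => k _; first by move=> _; apply: integral_ge0.
rewrite /f ge0_integralZl_EFin//; first last.
- exact: mulr_ge0.
- by apply/measurable_EFinP; exact: measurable_indic.
rewrite integral_indic// mulrAC [leRHS]EFinM.
apply: lee_wpmul2l; first by rewrite lee_fin mulr_ge0.
apply: (@le_trans _ _ (lebesgue_measure `[a k n, b k n]%classic)) => /=.
  by apply: le_measure; rewrite ?inE//; exact: measurableI.
rewrite lebesgue_measure_itv/= lte_fin; case: ltP => _//.
by rewrite lee_fin subr_ge0.
Qed.

(** The ball contains a cube of side [1 / n], whose indicator function is at most
    the sum of those of the boxes of any cover. *)
Lemma volume_unit_ball_gt0 (n : nat) : (0 < n)%N ->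
  (0 < volume (@unit_ball R n))%E.
Proof.
case: n => // n _; pose d : R := n.+1%:R^-1.
have d0 : 0 < d by rewrite invr_gt0.
apply: (@lt_le_trans _ _ (d ^+ n.+1)%:E); first by rewrite lte_fin exprn_gt0.
apply: le_ereal_inf_tmp => _ [p [p12 Bp] <-].
pose a k i := (p k).1 0 (inord i : 'I_n.+1).
pose b k i := (p k).2 0 (inord i : 'I_n.+1).
have volp k : \prod_(i < n.+1) ((p k).2 0 i - (p k).1 0 i) =
    1 * \prod_(i < n.+1) (b k i - a k i).
  by rewrite mul1r; apply: eq_bigr => i _; rewrite /a /b inord_val.
under eq_eseriesr do rewrite volp.
rewrite -[d ^+ _]mul1r.
apply: (weighted_box_cover (e := fun=> 1)) => // [|k i|x xd]; first exact: ltW.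
  exact: p12.
pose X : 'rV[R]_n.+1 := \row_i x i.
have /Bp[k _ Xk] : unit_ball X.
  rewrite /unit_ball/=; apply: (@le_trans _ _ (\sum_(i < n.+1) d)); last first.
    by rewrite sumr_const card_ord -mulr_natr mulVf.
  apply: ler_sum => i _; rewrite !mxE.
  have /andP[xi0 xid] := xd i; have d1 : d <= 1 by rewrite invf_le1// ler1n.
  by apply: le_trans (ler_pM xi0 xi0 xid xid) _; rewrite ler_piMl// ltW.
have t0 j : (0 <= ((1 : R) * \prod_(i < n.+1) (a j i <= x i <= b j i)%R%:R)%:E)%E.
  by rewrite mul1r lee_fin; apply: prodr_ge0 => i _; exact: ler0n.

apply: le_trans _ (nneseries_lim_ge k.+1 (fun j _ _ => t0 j)).
rewrite big_nat_recr//= [X in (_ <= _ + X)%E](_ : _ = 1%E).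
  by rewrite leeDr// sume_ge0.
rewrite mul1r big1// => i _; rewrite /a /b inord_val.
by have := Xk i; rewrite mxE => ->.
Qed.

Lemma volume_unit_ball_fin (n : nat) : (0 < n)%N ->
  volume (@unit_ball R n) \is a fin_num.
Proof.
move=> n0; rewrite ge0_fin_numE ?volume_ge0//.
apply: le_lt_trans (volume_le_finite_cover (N := 1)
  (q := fun=> (const_mx (-1), const_mx 1)) n0 _ _) _; last exact: ltry.
  by move=> _ i /=; rewrite !mxE ge0_cp.
move=> x x1; exists 0%N => // i; rewrite !mxE -ler_norml -(@ler_pXn2r _ 2) ?nnegrE//.
rewrite expr1n real_normK ?num_real// expr2.
apply: le_trans x1; rewrite /dot (bigD1 i)//= lerDl.
by apply: sumr_ge0 => j _; rewrite -expr2 sqr_ge0.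
Qed.

End UnitBallVolume.

(** * John's position from contact points *)

Section Cholesky.
Variable R : realType.

(** By induction on the dimension: the Schur complement of the top left entry is
    again symmetric and positive. *)
Lemma cholesky (n : nat) (S : 'M[R]_n) : S^T = S ->
  (forall x : 'rV[R]_n, x != 0 -> 0 < (x *m S *m x^T) 0 0) ->
  exists L : 'M[R]_n,
    [/\ is_trig_mx L, forall i, 0 < L i i & S = L *m L^T].
Proof.
elim: n S => [|n IH] S Ssym Spos.
  by exists 0; split => [||]; [exact: mx0_is_trig|case|apply/matrixP => -[]].
rewrite -[n.+1]/(1 + n)%N in S Ssym Spos *.
pose a := S 0 0; pose b := ursubmx S; pose C := drsubmx S.
have SE : S = block_mx a%:M b b^T C.
  rewrite -[LHS]submxK [ulsubmx S]mx11_scalar trmx_ursub Ssym.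
  by rewrite !mxE !lshift0.
have Csym : C^T = C by rewrite trmx_drsub Ssym.
have quad s (y : 'rV_n) :
    (row_mx s%:M y *m S *m (row_mx s%:M y)^T) 0 0 =
    s ^+ 2 * a + 2 * s * (y *m b^T) 0 0 + (y *m C *m y^T) 0 0.
  have byT : (b *m y^T) 0 0 = (y *m b^T) 0 0.
    by rewrite -[in RHS](trmxK y) -trmx_mul [RHS]mxE.
  rewrite SE mul_row_block tr_row_mx mul_row_col !mul_scalar_mx tr_scalar_mx.
  rewrite !mul_mx_scalar !mulmxDl -scalemxAl.
  have D00 (X Y : 'M[R]_1) : (X + Y) 0 0 = X 0 0 + Y 0 0 by rewrite mxE.
  have Z00 t (X : 'M[R]_1) : (t *: X) 0 0 = t * X 0 0 by rewrite mxE.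
  rewrite !(D00, Z00) byT mxE eqxx mulr1n; ring.
have a0 : 0 < a.
  have := Spos (row_mx 1%:M 0).
  rewrite quad !mul0mx !mxE expr1n mul1r mulr0 !addr0; apply.
  apply/eqP => /(congr1 lsubmx); rewrite row_mxKl linear0 => /matrixP/(_ 0 0)/eqP.
  by rewrite !mxE oner_eq0.
pose C' := C - a^-1 *: (b^T *m b).
have [||L' [L'trig L'pos C'E]] := IH C'.
- by rewrite linearB/= Csym linearZ/= trmx_mul trmxK.
- move=> y y0; pose s := - a^-1 * (y *m b^T) 0 0.
  have -> : (y *m C' *m y^T) 0 0 = (row_mx s%:M y *m S *m (row_mx s%:M y)^T) 0 0.
    have byT : b *m y^T = ((y *m b^T) 0 0)%:M.
      by rewrite [LHS]mx11_scalar -[in RHS](trmxK y) -trmx_mul [in RHS]mxE.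
    have -> : y *m C' *m y^T = y *m C *m y^T - a^-1 *: (y *m b^T *m (b *m y^T)).
      by rewrite /C' mulmxBr mulmxBl -scalemxAr -scalemxAl !mulmxA.
    rewrite byT mul_mx_scalar quad /s.
    have -> (X Y : 'M[R]_1) t t' : (X - t *: (t' *: Y)) 0 0 = X 0 0 - t * (t' * Y 0 0).
      by rewrite !mxE.
    field; exact: lt0r_neq0.
  apply: Spos; apply: contra_neq y0 => /(congr1 rsubmx).
  by rewrite row_mxKr linear0.
pose q := Num.sqrt a; have q0 : 0 < q by rewrite sqrtr_gt0.
have qq : q * q = a by rewrite -expr2 sqr_sqrtr// ltW.
exists (block_mx q%:M 0 (q^-1 *: b^T) L'); split.
- by rewrite is_trig_block_mx// eqxx scalar_mx_is_trig.
- move=> i; case: (split_ordP i) => j ->; last by rewrite block_mxEdr.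
  by rewrite block_mxEul mxE eqxx.
rewrite tr_block_mx mulmx_block !trmx0 !mulmx0 !mul0mx !addr0 tr_scalar_mx.
rewrite -scalar_mxM qq linearZ/= trmxK -!scalemxAl -!scalemxAr.
rewrite mul_scalar_mx mul_mx_scalar !scalerA mulVf ?divff ?lt0r_neq0// !scale1r.
by rewrite -invfM qq -C'E /C' addrC subrK.
Qed.

(** A matrix and the transposed Cholesky factor of its Gram matrix differ by a
    rotation, which preserves the ball. *)
Lemma ellipsoid_trig (n : nat) (c : 'rV[R]_n) (M : 'M[R]_n) : M \in unitmx ->
  exists L : 'M[R]_n, [/\ is_trig_mx L, forall i, 0 < L i i
    & [set c + x *m M | x in @unit_ball R n] =
      [set c + x *m L^T | x in @unit_ball R n]].
Proof.
move=> Munit.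
have [||L [Ltrig Lpos ML]] := @cholesky n (M^T *m M).
- by rewrite trmx_mul trmxK.
- move=> x x0.
  have -> : (x *m (M^T *m M) *m x^T) 0 0 = dot (x *m M^T) (x *m M^T).
    by rewrite dotE trmx_mul trmxK !mulmxA.
  apply: dot_gt0; apply: contra_neq x0 => xM0.
  have MTunit : M^T \in unitmx by rewrite unitmx_tr.
  by rewrite -(mulmxK MTunit x) xM0 mul0mx.
have Lunit : L \in unitmx.
  by rewrite unitmxE (det_trig Ltrig) unitfE; apply/prodf_neq0 => i _; rewrite lt0r_neq0.
pose O := M *m invmx L^T.
have ME : M = O *m L^T by rewrite mulmxKV ?unitmx_tr.
have OTO : O^T *m O = 1%:M.
  rewrite trmx_mul trmx_inv trmxK -mulmxA (mulmxA M^T) ML !mulmxA mulVmx//.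
  by rewrite mul1mx mulmxV ?unitmx_tr.
have OOT : O *m O^T = 1%:M by exact: mulmx1C.
have ballO (Q : 'M[R]_n) x : Q *m Q^T = 1%:M -> unit_ball x -> unit_ball (x *m Q).
  by rewrite /unit_ball/= => QQT; rewrite dot_mulmx -mulmxA QQT mulmx1.
exists L; split=> //; apply/seteqP; split => _ [x xB <-].
  by exists (x *m O); [exact: ballO|rewrite -mulmxA -ME].
exists (x *m O^T); first by apply: ballO; rewrite ?trmxK.
have OTM : O^T *m M = L^T by rewrite ME mulmxA OTO mul1mx.
by rewrite -mulmxA OTM.
Qed.


End Cholesky.

Section JohnPosition.
Variables (R : realType) (n : nat).

(** The sufficiency half of John's theorem. For an ellipsoid [x0 + B L^T] in [K]
    with [L] triangular, the support function in the direction [u i] gives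
    [|u i L| <= 1 - (u i, x0)]. Since [(u i L, u i) <= |u i L|], summing with the
    weights [c i] yields [\tr L <= n], whence [\det L <= 1]. If the volumes agree
    then all these inequalities are equalities: the [u i] are eigenvectors of [L],
    which is then symmetric, hence diagonal, hence the identity. *)
Lemma john_position_contact (I : finType) (u : I -> 'rV[R]_n) (c : I -> R)
    (K : set 'rV[R]_n) : (0 < n)%N ->
  (forall i, 0 < c i) -> (forall i, dot (u i) (u i) = 1) ->
  \sum_i c i *: u i = 0 -> \sum_i c i *: ((u i)^T *m u i) = 1%:M ->
  @unit_ball R n `<=` K -> (forall x i, K x -> dot (u i) x <= 1) ->
  john_position K.
Proof.
move=> n0 c0 u1 cu0 cuu BK Ku.
have trE (L : 'M[R]_n) : \sum_i c i * dot (u i *m L) (u i) = \tr L.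
  rewrite -[in RHS](mulmx1 L) -cuu mulmx_sumr raddf_sum/=.
  apply: eq_bigr => i _; rewrite -scalemxAr mxtraceZ dotE; congr (_ * _).
  by rewrite mulmxA mxtrace_mulC mulmxA trace_mx11.
have sumc : \sum_i c i = n%:R.
  rewrite -(mxtrace1 R n) -trE; apply: eq_bigr => i _.
  by rewrite mulmx1 u1 mulr1.
have volB0 := volume_unit_ball_gt0 R n0.
have volBfin := volume_unit_ball_fin R n0.
(* Every ellipsoid has the form x0 + B L^T considered here. *)
suff trig_case x0 (L : 'M[R]_n) : is_trig_mx L -> (forall i, 0 < L i i) ->
    [set x0 + x *m L^T | x in @unit_ball R n] `<=` K ->
    let vol := volume [set x0 + x *m L^T | x in @unit_ball R n] in
    (vol <= volume (@unit_ball R n))%E /\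
    ((volume (@unit_ball R n) <= vol)%E ->
      @unit_ball R n = [set x0 + x *m L^T | x in @unit_ball R n]).
  split.
    split => // [|E [x0 [M [Munit ->]]] EK].
      exists 0, 1%:M; split; first exact: unitmx1.
      by under eq_imagel => x _ do rewrite mulmx1 add0r; rewrite image_id.
    have [L [Ltrig Lpos ELE]] := ellipsoid_trig x0 Munit.
    by move: EK; rewrite ELE => /trig_case[].
  move=> E [[x0 [M [Munit ->]]] EK Emax].
  have [L [Ltrig Lpos ELE]] := ellipsoid_trig x0 Munit.
  move: EK Emax; rewrite ELE => /trig_case[]// _ volBE Emax.
  apply/volBE/Emax => //; exists 0, 1%:M; split; first exact: unitmx1.
  by under eq_imagel => x _ do rewrite mulmx1 add0r; rewrite image_id.
move=> Ltrig Lpos EK vol.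
pose r i := Num.sqrt (dot (u i *m L) (u i *m L)).
have r0 i : 0 <= r i by exact: sqrtr_ge0.
have rr i : r i * r i = dot (u i *m L) (u i *m L).
  by rewrite -expr2 sqr_sqrtr// dot_ge0.
have dr i : dot (u i *m L) (u i) <= r i.
  apply: le_trans (ler_norm _) _; rewrite -sqrtr_sqr ler_sqrt ?dot_ge0//.
  exact: dot_unit_sqr_le.
(* The point v of the ball where u i is largest on the ellipsoid; if r i = 0
   then v = 0, which serves as well. *)
have ri i : r i <= 1 - dot (u i) x0.
  pose v := (r i)^-1 *: (u i *m L).
  have Kx : K (x0 + v *m L^T).
    apply: EK; exists v => //; rewrite /unit_ball/= dotZl dotZr -rr mulrA mulrA.
    by have [->|ri0] := eqVneq (r i) 0; [rewrite mulr0|rewrite mulfVK// mulVf].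
  have := Ku _ i Kx; rewrite dotDr -dot_mulmx dotZr -rr.
  by have [->|ri0] := eqVneq (r i) 0; [rewrite !mulr0|rewrite mulKf//]; lra.
have sum_ri : \sum_i c i * (1 - dot (u i) x0) = n%:R.
  under eq_bigr do rewrite mulrBr mulr1.
  rewrite sumrB sumc [X in _ - X](_ : _ = dot (\sum_i c i *: u i) x0).
    by rewrite cu0 dot0l subr0.
  by rewrite dot_suml; apply: eq_bigr => i _; rewrite dotZl.
have trL : \tr L <= n%:R.
  rewrite -trE -sum_ri; apply: ler_sum => i _.
  by rewrite ler_pM2l//; exact: le_trans (dr i) (ri i).
have [AGM AGMeq] := leif_AGM (A := 'I_n) (E := fun i => L i i) (fun i _ => ltW (Lpos i)).
have tr0 : 0 <= \tr L / n%:R.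
  by rewrite divr_ge0// sumr_ge0// => i _; exact: ltW.
have trn1 : \tr L / n%:R <= 1 by rewrite ler_pdivrMr ?mul1r// ltr0n.
have detE : \prod_i L i i <= (\tr L / n%:R) ^+ n.
  by move: AGM; rewrite card_ord.
have volE : (vol <= (\prod_i L i i)%:E * volume (@unit_ball R n))%E.
  rewrite /vol (_ : [set _ | _ in _] =
      [set x0 + y | y in [set x *m L^T | x in @unit_ball R n]]); last first.
    by rewrite image_comp.
  apply: le_trans (volume_translate _ _ n0) _.
  apply: le_trans (volume_upper_trig _ _ _) _; first by rewrite trmxK.
    by move=> i; rewrite mxE.
  by under eq_bigr do rewrite mxE.
split.
  apply: le_trans volE _; rewrite -[leRHS]mul1e lee_wpmul2r ?volume_ge0//.
  by rewrite lee_fin (le_trans detE)// exprn_ile1.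
move=> volBE.
have det1 : 1 <= \prod_i L i i.
  rewrite leNgt; apply/negP => det1; have := le_trans volBE volE.
  rewrite -(fineK volBfin) -EFinM lee_fin leNgt gtr_pMl ?det1//.
  by rewrite fine_gt0// volB0/= ltey_eq volBfin.
have trn : \tr L / n%:R = 1.
  apply/eqP; rewrite eq_le trn1/= leNgt; apply/negP => tr1.
  have := le_trans det1 detE; rewrite leNgt => /negP; apply.
  by rewrite exprn_ilt1// -lt0n.
have nR0 : n%:R != 0 :> R by rewrite pnatr_eq0 -lt0n.
have trLn : \tr L = n%:R by rewrite -[LHS](divfK nR0) trn mul1r.
have Lii i : L i i = 1.
  have Lcst j : L j j = L i i.
    have : \prod_(j in 'I_n) L j j == (\tr L / #|'I_n|%:R) ^+ #|'I_n|.
      rewrite card_ord trn expr1n eq_le det1 andbT.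
      by move: detE; rewrite trn expr1n.
    by rewrite AGMeq => /forall_inP/(_ j isT)/forall_inP/(_ i isT)/eqP.
  apply: (mulIf nR0); rewrite mul1r -[RHS]trLn /mxtrace (eq_bigr _ (fun j _ => Lcst j)).
  by rewrite sumr_const card_ord mulr_natr.
have tight i : dot (u i *m L) (u i) = 1 - dot (u i) x0.
  have : \sum_i c i * (1 - dot (u i) x0 - dot (u i *m L) (u i)) == 0.
    under eq_bigr do rewrite mulrBr.
    by rewrite sumrB sum_ri trE trLn subrr.
  rewrite psumr_eq0 => [/allP/(_ i (mem_index_enum i))/=|j _].
    by rewrite mulf_eq0 gt_eqF//= subr_eq0 => /eqP.
  by rewrite mulr_ge0 ?(ltW (c0 j))// subr_ge0 (le_trans (dr j) (ri j)).
have eigen i : u i *m L = (1 - dot (u i) x0) *: u i.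
  apply/eqP; rewrite -subr_eq0; apply/eqP/dot_eq0.
  have rE : r i = 1 - dot (u i) x0.
    by apply/eqP; rewrite eq_le ri -tight dr.
  rewrite dotBl !dotBr !dotZl !dotZr (dotC (u i) (u i *m L)) tight u1 -rr rE.
  ring.
have Lsym : L^T = L.
  have LE : L = \sum_i (c i * (1 - dot (u i) x0)) *: ((u i)^T *m u i).
    rewrite -[LHS]mul1mx -cuu mulmx_suml; apply: eq_bigr => i _.
    by rewrite -scalemxAl -mulmxA eigen -scalemxAr scalerA.
  rewrite LE raddf_sum/=; apply: eq_bigr => i _.
  by rewrite linearZ/= trmx_mul trmxK.
have L1 : L = 1%:M.
  apply/matrixP => i j; rewrite !mxE; case: (ltngtP i j) => [ij|ji|/val_inj ->].
  - by rewrite (is_trig_mxP Ltrig)// -val_eqE/= (ltn_eqF ij).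
  - by rewrite -Lsym mxE (is_trig_mxP Ltrig)// -val_eqE/= (gtn_eqF ji).
  - by rewrite Lii eqxx.
have x00 : x0 = 0.
  rewrite -[LHS]mulmx1 -cuu mulmx_sumr big1// => i _.
  rewrite -scalemxAr mulmxA [x0 *m _]mx11_scalar -dotE dotC.
  have : dot (u i) x0 = 0 by have := tight i; rewrite L1 mulmx1 u1; lra.
  by move=> ->; rewrite mul_scalar_mx scale0r scaler0.
rewrite x00 L1 trmx1.
by under eq_imagel => x _ do rewrite mulmx1 add0r; rewrite image_id.
Qed.

End JohnPosition.

(** * Facets of polytopes *)

Section Facets.
Variables (R : realType) (n : nat).
Implicit Types (s : seq 'rV[R]_n) (u v w x d : 'rV[R]_n) (A : set 'rV[R]_n).

Lemma convex_halfspace u (t : R) :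
  convex_set ([set x | dot u x <= t] : set (convex_lmodType 'rV[R]_n)).
Proof.
move=> x y l; rewrite !inE /= => xt yt.
rewrite dotDr !dotZr; have l0 : 0 <= l%:num by [].
have l1 : 0 <= 1 - l%:num by rewrite subr_ge0.
have := lerD (ler_wpM2l l0 xt) (ler_wpM2l l1 yt).
by rewrite -mulrDl (addrC l%:num) subrK mul1r.
Qed.

Lemma dot_convex_hull_le s u (t : R) : (forall p, p \in s -> dot u p <= t) ->
  forall x, convex_hull [set` s] x -> dot u x <= t.
Proof.
move=> st x /(_ [set x | dot u x <= t]); apply; split; first exact: convex_halfspace.
by move=> p /=; exact: st.
Qed.

Lemma convex_hull_mem s p : p \in s -> convex_hull [set` s] p.
Proof. by move=> ps B [_]; apply. Qed.

Lemma convex_hull_nth s (i : 'I_(size s)) : convex_hull [set` s] s`_i.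
Proof. by apply: convex_hull_mem; apply: mem_nth. Qed.

Definition tight s u : {set 'I_(size s)} := [set i : 'I_(size s) | dot u s`_i == 1].

(** The tight points lie in the face and span the space linearly, so the
    hyperplane [dot u x = 1], which does not contain the origin, is their affine
    hull. *)
Lemma tight_hyperplane_facet s u (P := convex_hull [set` s])
    (F := P `&` [set x | dot u x = 1]) :
  u != 0 -> (forall x, P x -> dot u x <= 1) ->
  (forall d, (forall i : 'I_(size s), i \in tight s u -> dot d s`_i = 0) -> d = 0) ->
  facets P F.
Proof.
move=> u0 Pu span.
have Ftight (i : 'I_(size s)) : i \in tight s u -> F s`_i.
  by rewrite inE => /eqP si; split=> //; exact: convex_hull_nth.
have [i0 i0t] : exists i : 'I_(size s), i \in tight s u.
  apply/set0Pn; apply: contra_neqN u0 => /eqP t0.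
  by apply: span => i; rewrite t0 inE.
pose M := \matrix_(i < size s) (if i \in tight s u then s`_i else 0).
have Mfull : row_full M.
  rewrite /row_full -mxrank_tr -/(row_free M^T) -kermx_eq0; apply/eqP/row_matrixP => j.
  rewrite row0; apply: span => i it.
  have /matrixP/(_ j i) := mulmx_ker M^T.
  rewrite mxE [RHS]mxE => <-; apply: eq_bigr => k _; rewrite !mxE.
  by rewrite it.
have sub_hull y x V : F `<=` affine_subspace x V -> dot u y = 1 -> (y - x <= V)%MS.
  move=> FV y1; have /submxP[c yE] := submx_full y Mfull.
  have {}yE : y = \sum_(i in tight s u) c 0 i *: s`_i.
    rewrite yE mulmx_sum_row [RHS]big_mkcond/=; apply: eq_bigr => i _.
    by rewrite rowK; case: ifP => // _; rewrite scaler0.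
  have c1 : \sum_(i in tight s u) c 0 i = 1.
    rewrite -y1 yE dot_sumr; apply: eq_bigr => i.
    by rewrite inE dotZr => /eqP->; rewrite mulr1.
  have -> : y - x = \sum_(i in tight s u) c 0 i *: (s`_i - x).
    rewrite yE; under [RHS]eq_bigr do rewrite scalerBr.
    by rewrite sumrB -scaler_suml c1 scale1r.
  by apply: summx_sub => i it; apply/scalemx_sub/FV/Ftight.
have n0 : (0 < n)%N.
  rewrite lt0n; apply: contraNneq u0 => n0; apply/eqP/rowP => j.
  by have := ltn_ord j; rewrite [X in (_ < X)%N]n0.
split; first by exists u, 1.
exists n.-1; last by rewrite prednK.
exists s`_i0, (kermx u^T); split; last first.
  by rewrite mxrank_ker mxrank_tr rank_rV u0 subn1.
have kerE y : affine_subspace s`_i0 (kermx u^T) y <-> dot u y = 1.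
  have i01 : dot u s`_i0 = 1 by case: (Ftight _ i0t).
  rewrite /affine_subspace/=; split.
    move=> /sub_kermxP /matrixP/(_ 0 0); rewrite -dotE mxE dotBl dotC (dotC _ u) i01.
    by move/eqP; rewrite subr_eq0 => /eqP.
  move=> y1; apply/sub_kermxP.
  rewrite [LHS]mx11_scalar -dotE dotBl dotC (dotC _ u) y1 i01.
  by rewrite subrr; apply/matrixP => i j; rewrite !mxE mul0rn.
apply/seteqP; split => y.
  apply; split; first by exists s`_i0, (kermx u^T).
  by move=> x [_ x1]; exact/kerE.
move=> /kerE y1 B [[x [V ->]] FV].
exact: sub_hull FV y1.
Qed.

(** A functional bounded by [1] on a polytope can be pushed, without decreasing
    its value at [w], until the points where it is tight span the space: as long
    as they do not, move it in a direction [d] orthogonal to all of them and stop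
    at the first new tight point. There is one because the origin is interior.
    The last clause says that the facet determines its functional. *)
Lemma separating_facet s u0 w (P := convex_hull [set` s]) :
  @unit_ball R n `<=` P -> (forall x, P x -> dot u0 x <= 1) -> 1 < dot u0 w ->
  exists u, [/\ forall x, P x -> dot u x <= 1, 1 < dot u w,
    facets P (P `&` [set x | dot u x = 1]) &
    forall v, (forall x, (P `&` [set x | dot u x = 1]) x -> dot v x = 1) -> v = u].
Proof.
move=> BP Pu0 u0w.
have hullP u : (forall i : 'I_(size s), dot u s`_i <= 1) -> forall x, P x -> dot u x <= 1.
  move=> us; apply: dot_convex_hull_le => p /(nthP 0)[i si <-].
  exact: (us (Ordinal si)).
pose good u := (forall i : 'I_(size s), dot u s`_i <= 1) /\ 1 < dot u w.
have good0 : good u0.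
  by split => // i; exact: (Pu0 _ (convex_hull_nth i)).
have [u [[us uw] umax]] :
    exists u, good u /\ forall v, good v -> (#|tight s v| <= #|tight s u|)%N.
  pose Q k := `[< exists2 v, good v & #|tight s v| = k >].
  have exQ : exists k, Q k by exists #|tight s u0|; apply/asboolP; exists u0.
  have ubQ k : Q k -> (k <= size s)%N.
    by move=> /asboolP[v _ <-]; rewrite -[X in (_ <= X)%N]card_ord max_card.
  have [k /asboolP[u gu <-] kmax] := ex_maxnP exQ ubQ.
  by exists u; split=> // v gv; apply/kmax/asboolP; exists v.
have u_neq0 : u != 0 by apply: contraTneq uw => ->; rewrite dot0l ltr10.
(* The sign of d may be chosen so that its value at w is nonnegative. *)
have span_pos d : d != 0 -> 0 <= dot d w ->
    (forall i : 'I_(size s), i \in tight s u -> dot d s`_i = 0) -> False.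
  move=> d0 dw dt.
  (* Otherwise d would be at most 0 on P, which contains a multiple of d. *)
  have [i0 di0] : exists i : 'I_(size s), 0 < dot d s`_i.
    apply: contrapT => /forallNP dneg.
    have dP : forall x, P x -> dot d x <= 0.
      apply: dot_convex_hull_le => p /(nthP 0)[i si <-].
      by rewrite leNgt; apply/negP; exact: (dneg (Ordinal si)).
    have := dot_gt0 d0; set q := dot d d => q0.
    have : P ((Num.sqrt q)^-1 *: d).
      apply: BP; rewrite /unit_ball/= dotZl dotZr -/q mulrA -invfM -expr2.
      by rewrite sqr_sqrtr ?(ltW q0)// mulVf// gt_eqF.
    by move=> /dP; rewrite dotZr leNgt mulr_gt0// invr_gt0 sqrtr_gt0.
  pose ratio (i : 'I_(size s)) := (1 - dot u s`_i) / dot d s`_i.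
  case: (arg_minP (P := fun i : 'I_(size s) => 0 < dot d s`_i) ratio di0) => i di imin.
  pose t := ratio i; have t0 : 0 <= t by rewrite divr_ge0 ?subr_ge0// ltW.
  have gv : good (u + t *: d).
    split=> [j|]; last by rewrite dotDl dotZl; have := mulr_ge0 t0 dw; lra.
    rewrite dotDl dotZl; have [dj|dj] := ltP 0 (dot d s`_j).
      by rewrite -lerBrDl -ler_pdivlMr//; exact: imin.
    by have := us j; have := mulr_ge0_le0 t0 dj; lra.
  have := umax _ gv; rewrite leqNgt => /negP; apply; apply: proper_card.
  apply/properP; split.
    apply/fintype.subsetP => j jt; have := jt; rewrite !inE dotDl dotZl (dt _ jt).
    by rewrite mulr0 addr0.
  exists i; last by apply: contraTN di => /dt ->; rewrite ltxx.
  by rewrite inE dotDl dotZl /t /ratio divfK ?lt0r_neq0// addrC subrK.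
have span d : (forall i : 'I_(size s), i \in tight s u -> dot d s`_i = 0) -> d = 0.
  move=> dt; apply/eqP/negP => /negP d0.
  have [dw|/ltW dw] := leP 0 (dot d w); first exact: (span_pos d).
  apply: (span_pos (- d)) => [||i /dt di]; first by rewrite oppr_eq0.
    by rewrite dotNl oppr_ge0.
  by rewrite dotNl di oppr0.
exists u; split => //; first exact: hullP.
  by apply: tight_hyperplane_facet => //; exact: hullP.
move=> v Fv; apply/eqP; rewrite -subr_eq0; apply/eqP/span => i it.
have ui : dot u s`_i = 1 by apply/eqP; move: it; rewrite inE.
rewrite dotBl ui Fv ?subrr//; split=> //.
exact: convex_hull_nth.
Qed.

End Facets.

(** * The regular simplex *)

Section RegularSimplex.
Variables (R : realType) (n : nat).

(** The first [n] vertices are the basis vectors, rescaled and shifted along the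
    diagonal, and the last one is a negative multiple of the diagonal. The last
    property makes the vertices the contact points of a simplex in John's
    position. *)
Lemma regular_simplex : (0 < n)%N ->
  exists v : option 'I_n -> 'rV[R]_n,
    [/\ forall o o', dot (v o) (v o') = if o == o' then 1 else - n%:R^-1,
        \sum_o v o = 0
      & \sum_o (n%:R / n.+1%:R) *: ((v o)^T *m v o) = 1%:M].
Proof.
move=> n0; have nR0 : n%:R != 0 :> R by rewrite pnatr_eq0 -lt0n.
have n1R0 : n.+1%:R != 0 :> R by rewrite pnatr_eq0.
pose g : R := Num.sqrt (n%:R^-1).
pose a : R := Num.sqrt (n.+1%:R / n%:R).
pose b := (g - a) / n%:R.
have gg : g ^+ 2 = n%:R^-1 by rewrite sqr_sqrtr// invr_ge0.
have aa : a ^+ 2 = 1 + n%:R^-1.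
  by rewrite sqr_sqrtr ?divr_ge0// -natr1 mulrDl divff// mul1r.
have nb : n%:R * b = g - a by rewrite mulrC divfK.
pose one : 'rV[R]_n := const_mx 1.
have oneE u : dot u one = \sum_i u 0 i.
  by apply: eq_bigr => i _; rewrite mxE mulr1.
have dot11 : dot one one = n%:R.
  rewrite oneE (eq_bigr (fun=> 1)) => [|i _]; last by rewrite mxE.
  by rewrite sumr_const card_ord.
have dote1 i : dot (delta_mx 0 i) one = 1 by rewrite dotC dot_delta mxE.
have dotee i j : dot (delta_mx 0 i) (delta_mx 0 j) = (i == j)%:R :> R.
  by rewrite dot_delta mxE eqxx (eq_sym j).
pose v o := if o is Some i then a *: delta_mx 0 i + b *: one else - g *: one.
(* The identity behind all the entries of the Gram matrix. *)
have ab : 2 * a * b + n%:R * b ^+ 2 = - n%:R^-1.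
  have -> : 2 * a * b + n%:R * b ^+ 2 = b * (2 * a + n%:R * b) by ring.
  have -> : b = n%:R^-1 * (g - a) by rewrite mulrC.
  rewrite mulVKf//.
  have -> : n%:R^-1 * (g - a) * (2 * a + (g - a)) = n%:R^-1 * (g ^+ 2 - a ^+ 2) by ring.
  by rewrite gg aa; ring.
have vN o : dot (v o) (v None) = if o == None then 1 else - n%:R^-1.
  case: o => [i|] /=.
    rewrite dotZr dotDl !dotZl dote1 dot11 -gg (mulrC b) nb; ring.
  by rewrite dotZr dotZl dot11 mulrA mulrNN -expr2 gg mulVf.
have gram o o' : dot (v o) (v o') = if o == o' then 1 else - n%:R^-1.
  case: o' => [j|]; last exact: vN.
  case: o => [i|]; last by rewrite dotC vN.
  rewrite [dot _ _]/= dotDl !dotDr !dotZl !dotZr dote1 dot11 dotC (dotC one) dote1 dotee.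
  have -> : (Some i == Some j) = (i == j) by [].
  have -> : a * (a * (j == i)%:R) + a * (b * 1) + (b * (a * 1) + b * (b * n%:R)) =
    a ^+ 2 * (j == i)%:R + (2 * a * b + n%:R * b ^+ 2) by ring.
  rewrite ab aa (eq_sym j); case: eqP => _; rewrite ?(mulr1, mulr0); ring.
exists v; split => //.
- apply: dot_eq0; rewrite dot_suml big1// => o _; rewrite dot_sumr (bigD1 o)//=.
  rewrite gram eqxx (eq_bigr (fun=> - n%:R^-1)) => [|o' oo']; last first.
    by rewrite gram eq_sym (negbTE oo').
  rewrite sumr_const cardC1 card_option card_ord/=.
  by rewrite mulNrn -[n%:R^-1 *+ n]mulr_natr mulVf// subrr.
- rewrite -scaler_sumr (bigD1 None)//=.
  rewrite (reindex_omap Some id) => [|[]//].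
  rewrite (eq_bigl xpredT) => [|i]; last by rewrite eqxx.
  apply/matrixP => j k; rewrite !mxE summxE big_ord1 !mxE.
  rewrite (eq_bigr (fun i : 'I_n => a ^+ 2 * ((i == j)%:R * (i == k)%:R) +
    a * b * ((i == j)%:R + (i == k)%:R) + b ^+ 2)) => [|i _]; last first.
    rewrite !mxE big_ord1 !mxE !eqxx /= (eq_sym j) (eq_sym k); ring.
  have sumd (l : 'I_n) : \sum_i (i == l)%:R = 1 :> R.
    by rewrite (bigD1 l)//= eqxx big1 ?addr0// => i /negbTE ->.
  rewrite !big_split/= sumr_const card_ord -!mulr_sumr big_split/= !sumd.
  have -> : \sum_i (i == j)%:R * (i == k)%:R = (j == k)%:R :> R.
    rewrite (bigD1 j)//= eqxx mul1r big1 ?addr0// => i /negbTE ->; exact: mul0r.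
  rewrite -[b ^+ 2 *+ n]mulr_natr.
  have -> : - g * 1 * (- g * 1) + (a ^+ 2 * (j == k)%:R + a * b * (1 + 1) + b ^+ 2 * n%:R)
    = a ^+ 2 * (j == k)%:R + (g ^+ 2 + (2 * a * b + n%:R * b ^+ 2)) by ring.
  rewrite ab gg subrr addr0 mulrA.
  rewrite sqr_sqrtr ?divr_ge0//.
  by rewrite mulrA divfK// divff// mul1r.
Qed.

End RegularSimplex.

(** * The extremal body *)

Section HalfspaceIntersections.
Variables (R : realType) (n : nat).
Implicit Types (u : 'rV[R]_n) (K : set 'rV[R]_n).

Lemma dot_continuous u : continuous (dot u).
Proof.
move=> x; apply: (@cvg_big _ _ +%R 0 xpredT add_continuous _ (nbhs x)) => i _.
apply: (@cvgM _ _ (nbhs x)); first exact: cvg_cst.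
exact: (@coord_continuous R 1 n 0 i x).
Qed.

Lemma closed_halfspace u (t : R) : closed [set x | dot u x <= t].
Proof.
apply: (@closed_comp _ _ (dot u) [set y | y <= t]); last exact: closed_le.
by move=> x _; exact: dot_continuous.
Qed.

Lemma convex_set_bigcap (I : Type) (D : set I) (F : I -> set 'rV[R]_n) :
  (forall i, D i -> convex_set (F i : set (convex_lmodType 'rV[R]_n))) ->
  convex_set (\bigcap_(i in D) F i : set (convex_lmodType 'rV[R]_n)).
Proof.
move=> cF x y l; rewrite !inE => Fx Fy i Di; apply/set_mem/cF => //.
  by rewrite inE; exact: Fx.
by rewrite inE; exact: Fy.
Qed.

Lemma unit_ball_interior : interior (@unit_ball R n) 0.
Proof.
have dot_cont : (fun x : 'rV[R]_n => dot x x) x @[x --> (0 : 'rV[R]_n)]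
    --> dot (0 : 'rV[R]_n) 0.
  apply: (@cvg_big _ _ +%R 0 xpredT add_continuous _ (nbhs (0 : 'rV[R]_n))) => i _.
  by apply: (@cvgM _ _ (nbhs (0 : 'rV[R]_n))); exact: (@coord_continuous R 1 n 0 i 0).
rewrite dot0l in dot_cont.
have F0 := nbhs_filter (0 : 'rV[R]_n).
have near1 := @cvgr_lt _ _ _ F0 _ _ dot_cont 1 ltr01.
by apply: (@filterS _ _ F0 _ _ _ near1) => x /ltW.
Qed.

Lemma bounded_dot_compact K (t : R) : closed K ->
  (forall x, K x -> dot x x <= t) -> compact K.
Proof.
move=> Kcl Kt; pose M := t + 1.
have cM : compact [set x : 'rV[R]_n | forall i, x ord0 i \in `[- M, M]].
  apply: (@rV_compact _ _ (fun=> `[- M, M]%classic)) => _.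
  exact: segment_compact.
apply: subclosed_compact Kcl cM _ => x Kx i; rewrite /= in_itv/= -ler_norml.
have xit : x 0 i ^+ 2 <= t.
  apply: (le_trans _ (Kt x Kx)); rewrite /dot (bigD1 i)//= expr2 lerDl.
  by apply: sumr_ge0 => j _; rewrite -expr2 sqr_ge0.
rewrite /M -real_normK ?num_real// in xit *.
have := sqr_ge0 (`|x 0 i| - 1); have := sqr_ge0 `|x 0 i|; nra.
Qed.

End HalfspaceIntersections.

Section ExtremalBody.
Variables (R : realType) (n s : nat) (v : option 'I_n -> 'rV[R]_n).
Hypotheses (n0 : (0 < n)%N) (s0 : (0 < s)%N).
Hypothesis gram : forall o o', dot (v o) (v o') = if o == o' then 1 else - n%:R^-1.
Hypothesis sumv : \sum_o v o = 0.
Hypothesis frame : \sum_o (n%:R / n.+1%:R) *: ((v o)^T *m v o) = 1%:M.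
Implicit Types (I J : {set 'I_n}).

(** The functional y_I, which cuts off the point [spike I]. *)
Definition cap I : 'rV[R]_n := (2 * s%:R)^-1 *: \sum_(i in I) (v None - v (Some i)).

(** The point w_J. The coefficients make its products with the functionals
    [cap I] positive only for [I = J]; the scalar factor is the largest one, up to
    a constant, that keeps it inside the circumscribed simplex. *)
Definition spike J : 'rV[R]_n :=
  - (n%:R / (4 * s%:R ^+ 2)) *:
    ((2 * (s%:R - 1)) *: v None + (2 * s%:R) *: \sum_(j in J) v (Some j)).

Definition spiky_body : set 'rV[R]_n :=
  [set x | (forall o, dot (v o) x <= 1) /\
           (forall I, #|I| = s -> dot (cap I) x <= 1)].

Let nR0 : n%:R != 0 :> R. Proof. by rewrite pnatr_eq0 -lt0n. Qed.
Let sR0 : s%:R != 0 :> R. Proof. by rewrite pnatr_eq0 -lt0n. Qed.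
Let nRgt0 : 0 < n%:R :> R. Proof. by rewrite ltr0n. Qed.
Let sRge1 : 1 <= s%:R :> R. Proof. by rewrite ler1n. Qed.

Lemma dot_edge_None i : dot (v None - v (Some i)) (v None) = 1 + n%:R^-1.
Proof. by rewrite dotBl !gram/= opprK. Qed.

Lemma dot_edge_Some i j :
  dot (v None - v (Some i)) (v (Some j)) = - ((1 + n%:R^-1) * (i == j)%:R).
Proof.
rewrite dotBl !gram/= (_ : (Some i == Some j) = (i == j))//.
by case: eqP => _; rewrite ?mulr1 ?mulr0; ring.
Qed.

Lemma cap_unit I : #|I| = s -> dot (cap I) (cap I) <= 1.
Proof.
move=> Is; rewrite dotZl dotZr dot_suml.
have : \sum_(i in I) dot (v None - v (Some i)) (\sum_(j in I) (v None - v (Some j)))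
    <= \sum_(i in I) \sum_(j in I) 4.
  apply: ler_sum => i _; rewrite dot_sumr; apply: ler_sum => j _.
  rewrite dotBr dot_edge_None dot_edge_Some.
  have : n%:R^-1 <= 1 :> R by rewrite invf_le1// ler1n.
  by case: (i == j) => /=; lra.
rewrite !sumr_const Is -mulrnA -[4 *+ _]mulr_natr natrM => le4.
rewrite mulrA -invfM mulrC ler_pdivrMr ?mul1r; last first.
  by rewrite mulr_gt0// mulr_gt0// ltr0n.
by apply: le_trans le4 _; rewrite le_eqVlt; apply/orP; left; apply/eqP; ring.
Qed.

(** The edge from a vertex [i] to the base vertex detects whether [i] is in [J];
    the constants turn the sum over [I] into [#|I :&: J| - (s - 1)], which is
    positive only for [I = J]. *)
Lemma dot_cap_spike I J : #|I| = s ->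
  dot (cap I) (spike J) =
  n.+1%:R / (4 * s%:R ^+ 2) * (#|I :&: J|%:R - s%:R + 1).
Proof.
move=> Is; rewrite dotZl dot_suml.
have edgeJ i : dot (v None - v (Some i)) (spike J) =
    n.+1%:R / (4 * s%:R ^+ 2) * (2 * s%:R * (i \in J)%:R - 2 * (s%:R - 1)).
  rewrite dotZr dotDr !dotZr dot_edge_None dot_sumr.
  have -> : \sum_(j in J) dot (v None - v (Some i)) (v (Some j)) =
      - ((1 + n%:R^-1) * (i \in J)%:R).
    under eq_bigr do rewrite dot_edge_Some.
    rewrite sumrN -mulr_sumr; congr (- (_ * _)).
    have [iJ|iJ] := boolP (i \in J).
      rewrite (bigD1 i)//= eqxx big1 ?addr0// => j /andP[_ /negbTE].
      by rewrite eq_sym => ->.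
    by rewrite big1// => j jJ; case: eqP => // ij; rewrite ij jJ in iJ.
  by rewrite -natr1; field; rewrite sR0 nR0.
under eq_bigr do rewrite edgeJ.
rewrite -mulr_sumr sumrB sumr_const Is -mulr_sumr.
have -> : \sum_(i in I) (i \in J)%:R = #|I :&: J|%:R :> R.
  rewrite -sum1_card natr_sum big_mkcond [RHS]big_mkcond/=; apply: eq_bigr => i _.
  by rewrite inE; case: (i \in I); case: (i \in J).
by rewrite -[_ *+ s]mulr_natr; field; rewrite sR0.
Qed.

(** All scalar products of vertices are at least [- 1 / n], and the coefficients
    of the spike are nonpositive. *)
Lemma dot_vertex_spike o J : #|J| = s -> dot (v o) (spike J) <= 1.
Proof.
move=> Js; rewrite dotZr dotDr !dotZr dot_sumr.
have gramge o' : - n%:R^-1 <= dot (v o) (v o').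
  by rewrite gram; case: ifP.
have sumge : - (s%:R / n%:R) <= \sum_(j in J) dot (v o) (v (Some j)).
  apply: (le_trans _ (ler_sum _ (fun j _ => gramge (Some j)))).
  by rewrite sumr_const Js mulNrn lerN2 -[n%:R^-1 *+ s]mulr_natl.
have l1 : 2 * (s%:R - 1) * - n%:R^-1 <= 2 * (s%:R - 1) * dot (v o) (v None).
  by apply: ler_wpM2l => //; rewrite mulr_ge0// subr_ge0.
have l2 : 2 * s%:R * - (s%:R / n%:R) <=
    2 * s%:R * \sum_(j in J) dot (v o) (v (Some j)).
  by apply: ler_wpM2l; rewrite ?mulr_ge0.
set X := _ + _.
have XE : - (2 * (s%:R - 1 + s%:R ^+ 2)) / n%:R <= X.
  apply: (le_trans _ (lerD l1 l2)); rewrite le_eqVlt; apply/orP; left; apply/eqP; ring.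
have s4 : 0 < 4 * s%:R ^+ 2 :> R by rewrite mulr_gt0// exprn_gt0// ltr0n.
rewrite mulNr mulrAC lerNl ler_pdivlMr// mulN1r (mulrC n%:R).
rewrite ler_pdivrMr// in XE; apply: (le_trans _ XE); rewrite lerN2.
have := sqr_ge0 (s%:R - 1 : R); nra.
Qed.

Lemma unit_ball_spiky_body : @unit_ball R n `<=` spiky_body.
Proof.
move=> x x1; split=> [a|I Is]; apply: dot_le1 => //; first by rewrite gram eqxx.
exact: cap_unit.
Qed.

Lemma spiky_bodyE : spiky_body =
  (\bigcap_(o in [set: option 'I_n]) [set x | dot (v o) x <= 1]) `&`
  (\bigcap_(I in [set I : {set 'I_n} | #|I| = s]) [set x | dot (cap I) x <= 1]).
Proof.
apply/seteqP; split => x [xv xc]; split=> // a; [move=> _|]; exact: xv.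
Qed.

Lemma convex_body_spiky_body : convex_body spiky_body.
Proof.
split.
- apply: (@bounded_dot_compact _ _ _ (n%:R / n.+1%:R * (n.+1%:R * n%:R ^+ 2))).
    rewrite spiky_bodyE; apply: closedI; apply: closed_bigI => ? _;
      exact: closed_halfspace.
  move=> x [xv _].
  have lo o : - n%:R <= dot (v o) x.
    have : dot (\sum_o v o) x = 0 by rewrite sumv dot0l.
    rewrite dot_suml (bigD1 o)//= => /eqP; rewrite addr_eq0 => /eqP ->; rewrite lerN2.
    apply: le_trans (ler_sum _ (fun o' _ => xv o')) _.
    by rewrite sumr_const cardC1 card_option card_ord.
  have -> : dot x x = n%:R / n.+1%:R * \sum_o dot (v o) x ^+ 2.
    rewrite dotE -{1}(mulmx1 x) -frame -scaler_sumr -scalemxAr -scalemxAl mxE.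
    congr (_ * _).
    rewrite mulmx_sumr mulmx_suml summxE; apply: eq_bigr => o _.
    have -> : x *m ((v o)^T *m v o) *m x^T = (x *m (v o)^T) *m (v o *m x^T).
      by rewrite !mulmxA.
    by rewrite (mx11_scalar (x *m _)) -dotE mul_scalar_mx mxE -dotE dotC -expr2.
  rewrite ler_wpM2l ?divr_ge0//.
  apply: (@le_trans _ _ (\sum_(o : option 'I_n) n%:R ^+ 2)).
    apply: ler_sum => o _; rewrite -real_normK ?num_real//.
    rewrite ler_pXn2r ?nnegrE// ler_norml lo (le_trans (xv o))// ler1n//.
  by rewrite sumr_const card_option card_ord -[_ *+ _]mulr_natl.
- rewrite spiky_bodyE => x y l; rewrite !inE => -[xv xc] [yv yc]; split.
    apply/set_mem/convex_set_bigcap; rewrite ?inE// => o _; exact: convex_halfspace.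
  by apply/set_mem/convex_set_bigcap; rewrite ?inE// => o _; exact: convex_halfspace.
- exists 0; have F0 := nbhs_filter (0 : 'rV[R]_n).
  exact: (@filterS _ _ F0 _ _ unit_ball_spiky_body (unit_ball_interior R n)).
Qed.

Lemma john_position_spiky_body : john_position spiky_body.
Proof.
apply: (john_position_contact (u := v) (c := fun=> n%:R / n.+1%:R)) => //.
- by move=> _; rewrite divr_gt0// ltr0n.
- by move=> o; rewrite gram eqxx.
- by rewrite -scaler_sumr sumv scaler0.
- exact: unit_ball_spiky_body.
- by move=> x o [].
Qed.

End ExtremalBody.

(** * Counting facets *)

Lemma binomial_lower_bound (n s : nat) : (2 * s <= n)%N ->
  (n ^ s <= 'C(n, s) * (s`! * 2 ^ s))%N.
Proof.
move=> sn; rewrite mulnA bin_ffact ffact_prod mulnC.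
rewrite -[in X in (X <= _)%N](card_ord s) -[in X in (_ <= X * _)%N](card_ord s).
rewrite -!prod_nat_const -big_split/=; apply: leq_prod => i _.
have := ltn_ord i; lia.
Qed.

Lemma pigeonhole_fiber (T : finType) (A : {set T}) (h : T -> nat) (m N : nat) :
  (forall x, x \in A -> (h x < m)%N) -> (m * N < #|A|)%N ->
  exists l, (N < #|[set x in A | h x == l]%SET|)%N.
Proof.
move=> hm; apply: contraPP => /forallNP small; apply/negP; rewrite -leqNgt.
rewrite -sum1_card.
apply: (@leq_trans (\sum_(x in A) \sum_(l < m) (h x == l))%N).
  apply: leq_sum => x xA; rewrite (bigD1 (Ordinal (hm x xA)))//= eqxx; exact: leq_addr.
rewrite exchange_big/= -[m in leqRHS]card_ord -sum_nat_const.
apply: leq_sum => l _; have := small l; move/negP; rewrite -leqNgt.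
apply: leq_trans; rewrite -sum1_card [in leqRHS]big_mkcond [in leqLHS]big_mkcond/=.
by apply: leq_sum => x _; rewrite inE; case: (x \in A); case: (h x == l).
Qed.

Section FacetCount.
Variables (R : realType) (n s : nat) (v : option 'I_n -> 'rV[R]_n).
Hypotheses (n0 : (0 < n)%N) (s0 : (0 < s)%N).
Hypothesis gram : forall o o', dot (v o) (v o') = if o == o' then 1 else - n%:R^-1.
Notation K := (spiky_body s v).

(** Against [cap I] only the spike of [I] itself contributes positively to the
    average, and it contributes at most [(n + 1) / #|A|]. *)
Lemma mean_spikes_in_body (A : {set {set 'I_n}}) :
  (forall J, J \in A -> #|J| = s) -> (n < #|A|)%N ->
  K (#|A|%:R^-1 *: \sum_(J in A) spike s v J).
Proof.
move=> As nA; have A0 : 0 < #|A|%:R :> R by rewrite ltr0n (leq_ltn_trans _ nA).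
have s4 : 1 <= 4 * s%:R ^+ 2 :> R.
  by rewrite -natrX -natrM ler1n muln_gt0 expn_gt0 s0.
split=> [a|I Is]; rewrite dotZr dot_sumr mulrC ler_pdivrMr// mul1r.
  rewrite -sum1_card natr_sum; apply: ler_sum => J /As Js.
  exact: dot_vertex_spike.
apply: (@le_trans _ _ (\sum_(J in A) (J == I)%:R * n.+1%:R)).
  apply: ler_sum => J /As Js; rewrite dot_cap_spike//.
  have c0 : 0 <= n.+1%:R / (4 * s%:R ^+ 2) :> R by rewrite divr_ge0// (le_trans ler01).
  have [->|JI] := eqVneq J I.
    rewrite finset.setIid Is subrr add0r mulr1 mul1r ler_pdivrMr ?(lt_le_trans ltr01)//.
    by rewrite ler_peMr.
  rewrite mul0r mulr_ge0_le0//.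
  have : (#|I :&: J| < s)%N.
    rewrite -Is; apply: proper_card; rewrite finset.properEneq finset.subsetIl andbT.
    apply: contraNneq JI => IJ; rewrite eq_sym eqEcard Is Js leqnn andbT.
    by rewrite -IJ finset.subsetIr.
  by rewrite -(ler_nat R) -natr1; lra.
rewrite -mulr_suml; apply: (@le_trans _ _ (1 * n.+1%:R)); last by rewrite mul1r ler_nat.
apply: ler_wpM2r => //; have [IA|IA] := boolP (I \in A).
  by rewrite (bigD1 I)//= eqxx big1 ?addr0// => J /andP[_ /negbTE ->].
by rewrite big1// => J JA; case: eqP => // JI; rewrite -JI JA in IA.
Qed.

(** Each spike is separated from [P] by a facet, and by [mean_spikes_in_body] no
    facet separates more than [n] spikes. *)
Lemma facets_spiky_body (P : set 'rV[R]_n) (m : nat) (rho : R) :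
  (s <= n)%N -> 0 < rho -> rho * (4 * s%:R ^+ 2) < n.+1%:R ->
  polytope P -> (facets P #= `I_m)%card ->
  K `<=` P -> P `<=` dilate rho K -> ('C(n, s) <= m * n)%N.
Proof.
move=> sn rho0 rhos [S PS] facetsP KP PK.
have s4 : 0 < 4 * s%:R ^+ 2 :> R by rewrite mulr_gt0// exprn_gt0// ltr0n.
have BP : @unit_ball R n `<=` P.
  by apply: subset_trans KP; exact: unit_ball_spiky_body.
pose Q J (u : 'rV[R]_n) := [/\ forall x, P x -> dot u x <= 1, 1 < dot u (spike s v J),
    facets P (P `&` [set x | dot u x = 1]) &
    forall w, (forall x, (P `&` [set x | dot u x = 1]) x -> dot w x = 1) -> w = u].
have exQ (J : {set 'I_n}) : exists u, #|J| = s -> Q J u.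
  have [Js|Js] := eqVneq #|J| s; last by exists 0 => /eqP; rewrite (negbTE Js).
  have [u Qu] : exists u, Q J u.
    rewrite /Q; move: BP PK; rewrite PS => BP PK.
    (* The cap of J, rescaled, is a first functional that separates its spike. *)
    apply: (separating_facet (u0 := rho^-1 *: cap s v J)) => //.
      move=> _ /PK[x [_ xc] <-]; rewrite dotZl dotZr mulKf ?lt0r_neq0//.
      exact: xc.
    rewrite dotZl dot_cap_spike// finset.setIid Js subrr add0r mulr1 mulrC.
    by rewrite ltr_pdivlMr// mul1r ltr_pdivlMr.
  by exists u.
have [phi phiQ] := choice exQ.
pose F J := P `&` [set x | dot (phi J) x = 1].
have /card_set_bijP[f [fim finj _]] := facetsP.
pose Js : {set {set 'I_n}} := [set J : {set 'I_n} | #|J| == s]%SET.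
have JsE J : J \in Js -> #|J| = s by rewrite inE => /eqP.
have cardJs : #|Js| = 'C(n, s) by rewrite /Js card_draws card_ord.
rewrite leqNgt; apply/negP; rewrite -cardJs => large.
have [|l fiber_large] := pigeonhole_fiber (h := fun J => f (F J)) _ large.
  by move=> J /JsE /phiQ[_ _ FJ _]; exact: (fim _ FJ).
set A := [set J in Js | _]%SET in fiber_large.
have As J : J \in A -> #|J| = s by rewrite inE => /andP[/JsE].
have [J0 J0A] : exists J, J \in A by apply/card_gt0P; exact: leq_ltn_trans fiber_large.
have phiA J : J \in A -> phi J = phi J0.
  move=> JA; have [_ _ FJ uniqJ] := phiQ J (As J JA).
  have [_ _ FJ0 uniqJ0] := phiQ J0 (As J0 J0A).
  have FE : F J = F J0.
    apply: finj; rewrite ?inE//.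
    by move: JA J0A; rewrite !inE => /andP[_ /eqP ->] /andP[_ /eqP ->].
  by apply: uniqJ0 => x; rewrite -/(F J0) -FE => -[].
have [Pphi _ _ _] := phiQ J0 (As J0 J0A).
have A0 : 0 < #|A|%:R :> R by rewrite ltr0n (leq_ltn_trans _ fiber_large).
have := Pphi _ (KP _ (mean_spikes_in_body As fiber_large)).
rewrite dotZr dot_sumr mulrC ler_pdivrMr// mul1r leNgt => /negP; apply.
rewrite -sum1_card natr_sum; apply: ltr_sum => [|J JA].
  by apply/hasP; exists J0; [exact: mem_index_enum|].
by rewrite -(phiA _ JA); have [] := phiQ J (As J JA).
Qed.

End FacetCount.

Theorem corollary1p3 (R : realType) (r : nat -> R)
  (r_gt0 : forall n, (0 < n)%N -> 0 < r n)
  (r_incr : forall m n, (0 < m)%N -> (m <= n)%N -> r m <= r n)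
  (r_infty : r n @[n --> \oo] --> +oo%R)
  (r_small : r n / n%:R @[n --> \oo] --> (0 : R))
  (k : R) (k_gt0 : 0 < k) :
  \forall n \near \oo, exists K : set 'rV[R]_n,
    [/\ convex_body K, john_position K
      & ~ exists P : set 'rV[R]_n,
          [/\ polytope P,
              exists2 m : nat, (facets P #= `I_m)%card & m%:R <= n%:R `^ k,
              K `<=` P & P `<=` dilate (r n) K]].
Proof.
(* With n^(s-1) < 'C(n, s) and m <= n^t, the choice s = t + 2 leaves room for the
   factor n lost by the pigeonhole principle. *)
pose t := (Num.trunc k).+1; pose s := t.+2.
have kt : k <= t%:R by rewrite ltW// truncnS_gt.
have s4 : 0 < 4 * s%:R ^+ 2 :> R by rewrite mulr_gt0// exprn_gt0// ltr0n.
have r_lt : \forall n \near \oo, r n / n%:R < (4 * s%:R ^+ 2)^-1.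
  by apply: cvgr_lt r_small _ _; rewrite invr_gt0.
near=> n.
have n_large : (s`! * 2 ^ s < n)%N by near: n; exists (s`! * 2 ^ s).+1.
have sn2 : (2 * s <= n)%N by near: n; exact: nbhs_infty_ge.
have n0 : (0 < n)%N by exact: leq_ltn_trans n_large.
have n0R : 0 < n%:R :> R by rewrite ltr0n.
have [v [gram sumv frame]] := regular_simplex R n0.
exists (spiky_body s v); split.
- exact: convex_body_spiky_body.
- exact: john_position_spiky_body.
move=> [P [polyP [m facetsP mk] KP PK]].
have r_n : r n * (4 * s%:R ^+ 2) < n.+1%:R.
  have : r n / n%:R < (4 * s%:R ^+ 2)^-1 by near: n.
  rewrite ltr_pdivrMr// mulrC ltr_pdivlMr// => /lt_trans; apply.
  by rewrite ltr_nat.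
have sn : (s <= n)%N by lia.
have := facets_spiky_body n0 (isT : (0 < s)%N) gram sn (r_gt0 n n0) r_n
  polyP facetsP KP PK.
have mt : (m <= n ^ t)%N.
  rewrite -(ler_nat R) natrX -powR_mulrn ?ler0n//.
  by apply: le_trans mk _; apply: ler_powR; rewrite // ler1n.
apply/negP; rewrite -ltnNge.
apply: (@leq_ltn_trans (n ^ t.+1)); first by rewrite expnSr leq_mul2r mt orbT.
have := binomial_lower_bound sn2; rewrite [in X in (X <= _)%N]/s expnS => le_bin.
have c0 : (0 < s`! * 2 ^ s)%N by rewrite muln_gt0 fact_gt0 expn_gt0.
rewrite -(ltn_pmul2r c0); apply: leq_trans le_bin.
by rewrite mulnC ltn_pmul2r// expn_gt0 n0.
Unshelve. all: by end_near. Qed.
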